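(* Let $(G_n,\delta_n)_{n\in\mathbb{N}}$ be a Cauchy sequence of proper groups for $\Upsilon$ such that for all $\varepsilon>0$ there exist $\omega>0$ and $N\in\mathbb{N}$ such that for all $n\ge N$: $$\forall g,h\in G_n\quad \delta_n(g,h)<\omega\implies\delta_n(g^{-1},h^{-1})<\varepsilon.$$ Then there exists a proper group $(G,\delta)$ such that $\lim_{n\to\infty}\Upsilon((G_n,\delta_n),(G,\delta))=0$.
   Context: A metric monoid (resp. metric group) $(G,\delta)$ is a monoid (resp. group) $G$ with a left invariant metric $\delta$ (that is, $\delta(gh,gk)=\delta(h,k)$ for all $g,h,k\in G$) for which the multiplication is continuous (resp. the multiplication and the inverse function are continuous). It is proper when all its closed balls are compact; ''proper monoid'' and ''proper group'' mean proper metric monoid and proper metric group. For $r\ge 0$, $G[r]$ is the closed ball of radius $r$ centered at the identity element of $G$. Let $(G_1,\delta_1)$, $(G_2,\delta_2)$ be metric monoids with identity elements $e_1,e_2$, and let $\varepsilon\ge0$, $r\ge0$. $\mathrm{UIso}_{\varepsilon}((G_1,\delta_1)\to(G_2,\delta_2)\,|\,r)$ is the set of all ordered pairs $(\varsigma_1,\varsigma_2)$ of maps (not assumed continuous or multiplicative) $\varsigma_1:G_1\to G_2$, $\varsigma_2:G_2\to G_1$ such that for all $\{j,k\}=\{1,2\}$: $\varsigma_j(e_j)=e_k$, and for all $g,g'\in G_j[r]$ and $h\in G_k[r]$, $|\delta_k(\varsigma_j(g)\varsigma_j(g'),h)-\delta_j(gg',\varsigma_k(h))|\le\varepsilon$.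 The Gromov-Hausdorff monoid distance between proper metric monoids is $$\Upsilon((G_1,\delta_1),(G_2,\delta_2))=\min\left\{\tfrac{\sqrt2}{2},\inf\left\{\varepsilon>0:\mathrm{UIso}_\varepsilon\left((G_1,\delta_1)\to(G_2,\delta_2)\,\middle|\,\tfrac1\varepsilon\right)\neq\emptyset\right\}\right\}.$$ It is a metric up to isometric isomorphism of monoids. *)

(* Defs.v *)
From HB Require Import structures.
From mathcomp Require Import all_boot all_order all_algebra.
From mathcomp Require Import all_classical all_reals all_analysis.

Set Implicit Arguments.
Unset Strict Implicit.
Unset Printing Implicit Defensive.

Import Order.TTheory GRing.Theory Num.Theory.
Import numFieldNormedType.Exports.

Local Open Scope classical_set_scope.
Local Open Scope ring_scope.

(* Not [closed_ball], which is the closure of the open ball and can be strictly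
   smaller in a general metric space. *)
Definition mclosed_ball (R : realType) (T : metricType R) (x : T) (r : R) :
  set T := [set y | mdist x y <= r].

HB.mixin Record isMetricMonoid (R : realType) M of Metric R M & Monoid M := {
  mdist_mul2l : forall g h k : M, mdist (g * h)%g (g * k)%g = mdist h k ;
  mulg_continuous : continuous (fun p : M * M => (p.1 * p.2)%g)
}.

#[short(type="metricMonoidType")]
HB.structure Definition MetricMonoid (R : realType) :=
  { M of Metric R M & Monoid M & isMetricMonoid R M }.

HB.mixin Record isMetricGroup (R : realType) G of MetricMonoid R G & Group G
  := { invg_continuous : continuous (fun g : G => (g^-1)%g) }.

#[short(type="metricGroupType")]
HB.structure Definition MetricGroup (R : realType) :=
  { G of MetricMonoid R G & Group G & isMetricGroup R G }.

HB.mixin Record isProperMetric (R : realType) T of Metric R T := {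
  mclosed_ball_compact : forall (x : T) (r : R), compact (mclosed_ball x r)
}.

#[short(type="properMonoidType")]
HB.structure Definition ProperMonoid (R : realType) :=
  { M of MetricMonoid R M & isProperMetric R M }.

#[short(type="properGroupType")]
HB.structure Definition ProperGroup (R : realType) :=
  { G of MetricGroup R G & isProperMetric R G }.

Definition idball (R : realType) (G : metricMonoidType R) (r : R) : set G :=
  mclosed_ball (1%g : G) r.

(* The conditions on (s1, s2) for (j, k) = (1, 2). *)
Definition almost_iso (R : realType) (G1 G2 : metricMonoidType R) (eps r : R)
    (s1 : G1 -> G2) (s2 : G2 -> G1) : Prop :=
  s1 1%g = 1%g /\
  forall (g g' : G1) (h : G2), idball r g -> idball r g' -> idball r h ->
    `| mdist (s1 g * s1 g')%g h - mdist (g * g')%g (s2 h) | <= eps.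

Definition UIso (R : realType) (G1 G2 : metricMonoidType R) (eps r : R) :
    set ((G1 -> G2) * (G2 -> G1)) :=
  [set s | almost_iso eps r s.1 s.2 /\ almost_iso eps r s.2 s.1].
Arguments UIso {R} G1 G2 eps r _.

Definition UIso_eps (R : realType) (G1 G2 : metricMonoidType R) : set R :=
  [set eps | 0 < eps /\ UIso G1 G2 eps eps^-1 !=set0].

(* [inf] is meaningful here: [UIso_eps G1 G2] is bounded below by 0 and, by
   [UIso_eps_sqrt2] below, never empty. *)
Definition Upsilon (R : realType) (G1 G2 : properMonoidType R) : R :=
  Num.min (Num.sqrt 2 / 2) (inf (UIso_eps G1 G2)).

Lemma UIso_eps_sqrt2 (R : realType) (G1 G2 : metricMonoidType R) :
  UIso_eps G1 G2 (Num.sqrt 2).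
Proof.
have s0 : 0 < Num.sqrt 2 :> R by rewrite sqrtr_gt0.
have sV : 2 * (Num.sqrt 2)^-1 = Num.sqrt 2 :> R.
  by rewrite -[X in X * _](sqr_sqrtr (ler0n R 2)) expr2 mulfK ?gt_eqF.
suff H (A B : metricMonoidType R) :
    almost_iso (Num.sqrt 2) (Num.sqrt 2)^-1 (fun _ : A => 1%g : B)
               (fun _ : B => 1%g : A).
  by split=> //; exists (fun=> 1%g, fun=> 1%g); split; apply: H.
split=> // g g' h; rewrite /idball /mclosed_ball /= mulg1 => g1 g1' h1.
have gg : mdist (g * g')%g (1%g : A) <= Num.sqrt 2.
  rewrite metric_sym (le_trans (metric_triangle _ g _))// -sV mulr2n mulrDl mul1r.
  apply: lerD => //; rewrite -{1}[g]mulg1 mdist_mul2l; exact: g1'.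
have hs : mdist (1%g : B) h <= Num.sqrt 2.
  rewrite (le_trans h1)// -[leRHS]sV ler_peMl ?ler1n // invr_ge0 ltW.
rewrite ler_norml; apply/andP; split.
  by rewrite lerBrDl lerBlDr (le_trans gg)// lerDr mdist_ge0.
by rewrite lerBlDr (le_trans hs)// lerDl mdist_ge0.
Qed.

Definition Upsilon_cauchy (R : realType) (G : nat -> properMonoidType R) :
    Prop :=
  forall eps : R, 0 < eps -> exists N : nat, forall m n : nat,
    (N <= m)%N -> (N <= n)%N -> Upsilon (G m) (G n) < eps.

(* Main.v *)
(* The limit is the metric ultraproduct L of the G_n along an ultrafilter U
   finer than the Frechet filter: bounded sequences (x_n) modulo
   lim_U d(x_n, y_n) = 0.
   By left invariance, d(gk, hk) = d((k^-1 g^-1)^-1, (k^-1 h^-1)^-1), so the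
   equicontinuity of the inverses makes right translations equicontinuous too;
   hence the group operations descend to L and are continuous.  L is complete by
   a diagonal argument.  If for U-almost all m there is an e'-isometry between
   P and G_m, then the ultralimit of these maps, which exists because balls of P
   are compact, is an e-isometry between P and L for every e > e'.  Applied to
   P = G_n, this gives both the convergence and, together with completeness, the
   compactness of the balls of L. *)
Require Import Defs.
From HB Require Import structures.
From mathcomp Require Import all_boot all_order all_algebra.
From mathcomp Require Import all_classical all_reals all_analysis.
From mathcomp Require Import generic_quotient lra.

Import Order.TTheory GRing.Theory Num.Theory.
Import numFieldNormedType.Exports.

Local Open Scope quotient_scope.
Local Open Scope classical_set_scope.
Local Open Scope ring_scope.

Set Implicit Arguments.
Unset Strict Implicit.
Unset Printing Implicit Defensive.

(** * Ultrafilters and limits of distances and products *)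

Lemma ultra_fmap (S T : Type) (f : S -> T) (F : set_system S) :
  UltraFilter F -> UltraFilter (f @ F).
Proof.
move=> UF; split; first exact: fmap_proper_filter.
move=> H PH FH; apply/seteqP; split=> // A HA.
have [//|FnA] := in_ultra_setVsetC (f @^-1` A) UF.
have HnA : H (~` A) by exact: FH.
by have /filter_ex[x []] : H (A `&` ~` A) by exact: filterI.
Qed.

Section mdist_lemmas.
Context {R : realType} {T : metricType R}.
Implicit Types (x y z : T).

Lemma ler_mdist_quad x y x' y' :
  `|mdist x y - mdist x' y'| <= mdist x x' + mdist y y'.
Proof.
have := metric_triangle x' x y; have := metric_triangle x y y'.
have := metric_triangle x x' y; have := metric_triangle x' y' y.
have := metric_triangle x' x y'.
rewrite (metric_sym x' x) (metric_sym y' y) ler_distl => *.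
by apply/andP; split; lra.
Qed.

Lemma cvg_mdist {I : Type} (F : set_system I) {FF : Filter F}
    (f g : I -> T) x y :
  f @ F --> x -> g @ F --> y -> mdist (f i) (g i) @[i --> F] --> mdist x y.
Proof.
move=> /metricType_numDomainType.cvgr_dist_le fx.
move=> /metricType_numDomainType.cvgr_dist_le gy.
apply/cvgrPdist_le => e e0.
have e2 : 0 < e / 2 by rewrite divr_gt0.
near=> i; rewrite (le_trans (ler_mdist_quad _ _ _ _))// [leRHS]splitr lerD//.
  by near: i; exact: fx.
by near: i; exact: gy.
Unshelve. all: by end_near. Qed.

Lemma mclosed_ball_cvg x (r : R) (F : set_system T) {FF : ProperFilter F} y :
  F (mclosed_ball x r) -> F --> y -> mclosed_ball x r y.
Proof.
move=> Fr Fy; have xFy : mdist x z @[z --> F] --> mdist x y.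
  by apply: cvg_mdist => //; exact: cvg_cst.
exact: (cvgr_to_le xFy).
Qed.

End mdist_lemmas.

Lemma mulg_cvg {R : realType} (M : metricMonoidType R) {I : Type}
    (F : set_system I) {FF : Filter F} (f g : I -> M) (x y : M) :
  f @ F --> x -> g @ F --> y -> (f i * g i)%g @[i --> F] --> (x * y)%g.
Proof.
move=> fx gy.
apply: (@cvg_comp _ _ _ (fun i => (f i, g i)) _ _ _ _ _
  (@mulg_continuous R M (x, y))).
exact: cvg_pair.
Qed.

(** The image ultrafilter contains a compact segment, hence converges. Distances between bounded
    sequences thereby get limits along [U]. *)
Lemma ultra_bounded_cvg {R : realType} {I : Type} (F : set_system I)
    {UF : UltraFilter F} (u : I -> R) (a b : R) :
  (\forall i \near F, a <= u i <= b) -> cvg (u @ F).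
Proof.
move=> ub; have := @segment_compact R a b; rewrite compact_ultra.
case/(_ _ (ultra_fmap u UF)) => [|l [_ ul]]; last by apply/cvg_ex; exists l.
by near=> i; rewrite /= in_itv/=; near: i.
Unshelve. all: by end_near. Qed.

(** * Almost isometries *)

Section almost_iso_theory.
Context {R : realType}.
Implicit Types A B : metricMonoidType R.

Lemma idball_le A (r r' : R) : r <= r' -> @idball R A r `<=` @idball R A r'.
Proof. by move=> rr g /le_trans; apply. Qed.

Lemma UIso_le A B (e e' r r' : R) :
  e' <= e -> r <= r' -> UIso A B e' r' `<=` UIso A B e r.
Proof.
move=> ee rr st; suff H (C D : metricMonoidType R) (s : C -> D) t :
    almost_iso e' r' s t -> almost_iso e r s t by case=> /H ? /H.
case=> s1 sP; split=> // g g' h gr g'r hr; rewrite (le_trans _ ee)//.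
by apply: sP; exact: idball_le rr _ _.
Qed.

Lemma idball1 A (r : R) : 0 <= r -> idball r (1%g : A).
Proof. by move=> r0; rewrite /idball /mclosed_ball/= mdistxx. Qed.

Lemma almost_iso_dist A B (e r : R) (s : A -> B) (t : B -> A) g h :
  0 <= r -> almost_iso e r s t -> idball r g -> idball r h ->
  `|mdist (s g) h - mdist g (t h)| <= e.
Proof.
move=> r0 [s1 sP] gr hr.
by have := sP g 1%g h gr (@idball1 A _ r0) hr; rewrite s1 !mulg1.
Qed.

(** Compare with [h = 1], which [st.2] fixes. When [B] is proper, this confines the images of a ball
    to a compact set. *)
Lemma UIso_norm A B (e r : R) st g :
  0 <= r -> UIso A B e r st -> idball r g -> mdist 1%g (st.1 g) <= r + e.
Proof.
move=> r0 [sP tP] gr.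
have := almost_iso_dist r0 sP gr (@idball1 B _ r0).
rewrite tP.1 metric_sym (metric_sym g) ler_distl => /andP[_].
by move=> /le_trans; apply; rewrite lerD.
Qed.

Lemma UIso_sym A B (e r : R) st : UIso A B e r st -> UIso B A e r (st.2, st.1).
Proof. by case. Qed.

Lemma Upsilon_ge0 (A B : properMonoidType R) : 0 <= Upsilon A B.
Proof.
rewrite /Upsilon le_min; apply/andP; split; first by rewrite divr_ge0.
apply: lb_le_inf; first by exists (Num.sqrt 2); exact: UIso_eps_sqrt2.
by move=> e [/ltW].
Qed.

Lemma Upsilon_le (A B : properMonoidType R) (e : R) :
  0 < e -> UIso A B e e^-1 !=set0 -> Upsilon A B <= e.
Proof.
move=> e0 ABe; rewrite /Upsilon ge_min; apply/orP; right; apply: ge_inf => //.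
by exists 0 => x [/ltW].
Qed.

(** The bound on [e] excludes the truncation, so the infimum itself is below [e]. Passing from some
    [x < e] to [e] loosens the error and shrinks the radius. *)
Lemma Upsilon_lt (A B : properMonoidType R) (e : R) :
  e <= Num.sqrt 2 / 2 -> Upsilon A B < e -> UIso A B e e^-1 !=set0.
Proof.
move=> e2; rewrite /Upsilon gt_min ltNge e2/= => /inf_lt[|x [x0 [st xst]] xe].
  by exists (Num.sqrt 2); exact: UIso_eps_sqrt2.
exists st; apply: UIso_le xst; first exact: ltW.
by rewrite lef_pV2 ?posrE ?(ltW xe)// (lt_trans x0 xe).
Qed.

(* An ultrafilter concentrated on a ball of [L] is pushed by an almost isometry
   to one concentrated on a ball of [P]; pulling a limit point of the latter
   back to [L] shows that the former is Cauchy. *)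
Lemma UIso_compact (L : metricMonoidType R) :
  (forall F : set_system L, ProperFilter F -> cauchy_ex F ->
     exists y : L, F --> y) ->
  (forall e : R, 0 < e ->
     exists P : properMonoidType R, UIso P L e e^-1 !=set0) ->
  forall (x : L) (r : R), compact (mclosed_ball x r).
Proof.
move=> Lcomplete LP x r; rewrite compact_ultra => F UF Fr.
suff /Lcomplete[y Fy] : cauchy_ex F.
  by exists y; split=> //; exact: mclosed_ball_cvg Fr Fy.
move=> e e0.
(* If this sum is negative, the ball is empty, which a proper filter excludes. *)
have [r1|r1] := ltP (mdist 1%g x + r) 0.
  have /filter_ex[y /= yr] := Fr.
  have := mdist_ge0 (1%g : L) y; rewrite leNgt => /negP[].
  rewrite (le_lt_trans _ r1)// (le_trans (metric_triangle _ x _))//.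
  by rewrite lerD.
set q := mdist 1%g x + r in r1.
(* The final estimate costs [2 * d < e]. The radius [d^-1] must contain both the given ball of [L]
   and the ball of radius [q + d] of [P] that receives its image. *)
pose d := Num.min (e / 3) (q + 1 + e)^-1.
have q0 : 0 < q + 1 + e by lra.
have d0 : 0 < d by rewrite lt_min invr_gt0 q0 divr_gt0.
have de : d <= e / 3 by rewrite ge_min lexx.
have dV : q + 1 + e <= d^-1.
  by rewrite -[leLHS]invrK lef_pV2 ?posrE ?invr_gt0// ge_min lexx orbT.
have dV0 : 0 <= d^-1 by lra.
have [P [st stP]] := LP d d0.
have Fd : F (idball d^-1).
  apply: filterS Fr => y; rewrite /idball /mclosed_ball/= => yr.
  by have := metric_triangle 1%g x y; rewrite /q in r1 dV *; lra.
have tF : F (st.2 @^-1` idball (q + d)).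
  apply: filterS2 Fr Fd => y; rewrite /mclosed_ball/= => yr yd.
  have := almost_iso_dist dV0 stP.2 yd (@idball1 P _ dV0).
  rewrite stP.1.1 ler_distl (metric_sym (st.2 y)) (metric_sym y) => /andP[_].
  rewrite /idball/mclosed_ball/= => /le_trans; apply.
  by have := metric_triangle 1%g x y; rewrite /q; lra.
have := @mclosed_ball_compact R P 1%g (q + d); rewrite compact_ultra.
case/(_ _ (ultra_fmap st.2 UF) tF) => g /= [gq tg]; exists (st.1 g).
have tgd : \forall y \near F, mdist g (st.2 y) < d.
  exact: (@metricType_numDomainType.cvgr_dist_lt R P _ F _ st.2 g tg).
apply: filterS2 Fd tgd => y yd gty; rewrite ballEmdist/=.
have gd : idball d^-1 g by rewrite /idball /mclosed_ball/= in gq *; lra.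
have := almost_iso_dist dV0 stP.1 gd yd; rewrite ler_distl; lra.
Qed.

End almost_iso_theory.

(** * The metric ultraproduct *)

Section ultraproduct.
Context {R : realType} (G : nat -> metricGroupType R).
Context (U : set_system nat) {UU : UltraFilter U}.

Definition bounded_seq (x : forall n, G n) : Prop :=
  exists M, forall n, mdist 1%g (x n) <= M.

Definition bseq := {x : forall n, G n | `[< bounded_seq x >]}.
HB.instance Definition _ := Choice.on bseq.

Definition mk_bseq x (bx : bounded_seq x) : bseq := exist _ x (asboolT bx).

Definition udist (x y : bseq) : R :=
  lim (mdist (val x n) (val y n) @[n --> U]).

Lemma udist_cvg (x y : bseq) :
  mdist (val x n) (val y n) @[n --> U] --> udist x y.
Proof.
have [/asboolP[M xM] /asboolP[N yN]] := (valP x, valP y).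
apply: (@ultra_bounded_cvg _ _ _ _ _ 0 (M + N)); near=> n.
rewrite mdist_ge0/= (le_trans (metric_triangle _ 1%g _))//.
by rewrite metric_sym lerD.
Unshelve. all: by end_near. Qed.

Lemma udistxx x : udist x x = 0.
Proof.
apply: cvg_lim => //; under eq_fun do rewrite mdistxx; exact: cvg_cst.
Qed.

Lemma udistC x y : udist x y = udist y x.
Proof. by congr lim; under eq_fun do rewrite metric_sym. Qed.

Lemma udist_triangle y x z : udist x z <= udist x y + udist y z.
Proof.
apply: (ler_cvg_to (@udist_cvg x z) (cvgD (@udist_cvg x y) (@udist_cvg y z))).
by apply: nearW => n; exact: metric_triangle.
Qed.

Lemma udist_ge0 x y : 0 <= udist x y.
Proof.
by apply: (cvgr_to_ge (@udist_cvg x y)); apply: nearW => n; exact: mdist_ge0.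
Qed.

Definition ueq (x y : bseq) : bool := udist x y == 0.

Lemma ueq_equiv : equiv_class_of ueq.
Proof.
split=> [x|x y|y x z]; rewrite /ueq; first by rewrite udistxx.
  by rewrite udistC.
move=> /eqP xy /eqP yz; rewrite eq_le udist_ge0 andbT.
by rewrite (le_trans (udist_triangle y _ _))// xy yz addr0.
Qed.

Canonical ueq_rel := EquivRelPack ueq_equiv.

Lemma udist_congr x x' y y' : ueq x x' -> ueq y y' -> udist x y = udist x' y'.
Proof.
have H a a' b b' : ueq a a' -> ueq b b' -> udist a b <= udist a' b'.
  move=> /eqP aa /eqP bb; rewrite (le_trans (udist_triangle a' _ _))// aa add0r.
  by rewrite (le_trans (udist_triangle b' _ _))// (udistC b') bb addr0.
move=> xx yy; apply/eqP; rewrite eq_le !H//.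
  by rewrite /ueq udistC.
by rewrite /ueq udistC.
Qed.

Definition equi_inv := forall e : R, 0 < e -> exists2 w : R, 0 < w &
  \forall n \near U, forall g h : G n,
    mdist g h < w -> mdist (g^-1)%g (h^-1)%g < e.

(** The type carries the proof of equicontinuity so that the group structure, whose operations
    descend to classes by it, can be attached to the type. *)
Definition ultraproduct (_ : equi_inv) : Type := {eq_quot ueq_rel}.

Context (Ginv : equi_inv).
Local Notation L := (ultraproduct Ginv).
Local Notation cls := (\pi_({eq_quot ueq_rel})%qT : bseq -> L).
Local Notation rep := (repr : L -> bseq).

HB.instance Definition _ := Choice.copy L {eq_quot ueq_rel}.

Lemma ueqP x y : reflect (cls x = cls y) (ueq x y).
Proof. by apply: (iffP idP) => [h|/eqmodP]; [exact/eqmodP|]. Qed.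

Lemma clsK (p : L) : cls (rep p) = p. Proof. exact: reprK. Qed.

Lemma repK x : ueq (rep (cls x)) x.
Proof. by apply/ueqP; rewrite clsK. Qed.

Definition up_dist (p q : L) : R := udist (rep p) (rep q).

Lemma up_distE x y : up_dist (cls x) (cls y) = udist x y.
Proof. by apply: udist_congr; exact: repK. Qed.

Lemma up_distxx p : up_dist p p = 0. Proof. exact: udistxx. Qed.
Lemma up_dist_eq0 p q : up_dist p q = 0 -> p = q.
Proof. by move/eqP/ueqP; rewrite !clsK. Qed.
Lemma up_distC p q : up_dist p q = up_dist q p. Proof. exact: udistC. Qed.
Lemma up_dist_triangle q p r : up_dist p r <= up_dist p q + up_dist q r.
Proof. exact: udist_triangle. Qed.

HB.instance Definition _ := isMetric.Build R L
  up_distxx up_dist_eq0 up_distC up_dist_triangle.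

Lemma mdist_cls x y : mdist (cls x : L) (cls y) = udist x y.
Proof. exact: up_distE. Qed.

(** * Group operations on classes of bounded sequences *)

Lemma bounded_seq1 : bounded_seq (fun n => 1%g).
Proof. by exists 0 => n; rewrite mdistxx. Qed.

Lemma bounded_seqM (x y : bseq) : bounded_seq (fun n => (val x n * val y n)%g).
Proof.
have [/asboolP[M xM] /asboolP[N yN]] := (valP x, valP y).
exists (M + N) => n; rewrite (le_trans (metric_triangle _ (val x n) _))//.
rewrite -[X in mdist X (_ * _)%g]mulg1 mdist_mul2l.
by rewrite lerD//; [exact: xM|exact: yN].
Qed.

Lemma bounded_seqV (x : bseq) : bounded_seq (fun n => ((val x n)^-1)%g).
Proof.
have /asboolP[M xM] := valP x; exists M => n.
rewrite -(mdist_mul2l (val x n)) mulg1 mulgV metric_sym; exact: xM.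
Qed.

Definition bone := mk_bseq bounded_seq1.
Definition bmul x y := mk_bseq (bounded_seqM x y).
Definition binv x := mk_bseq (bounded_seqV x).

Lemma udist_le_near (x y : bseq) (e : R) :
  (\forall n \near U, mdist (val x n) (val y n) <= e) -> udist x y <= e.
Proof. exact: (cvgr_to_le (@udist_cvg x y)). Qed.

Lemma udist_lt_near (x y : bseq) (e : R) :
  udist x y < e -> \forall n \near U, mdist (val x n) (val y n) < e.
Proof. exact: (cvgr_lt _ (@udist_cvg x y)). Qed.

Lemma binv_equi (e : R) : 0 < e -> exists2 w : R, 0 < w &
  forall x y, udist x y < w -> udist (binv x) (binv y) <= e.
Proof.
move=> /Ginv[w w0 H]; exists w => // x y /udist_lt_near xy.
by apply: udist_le_near; apply: filterS2 H xy => n H /H/ltW.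
Qed.

Lemma bmul2l x y z : udist (bmul x y) (bmul x z) = udist y z.
Proof. by congr lim; under eq_fun do rewrite mdist_mul2l. Qed.

Lemma bmul_equir (e : R) : 0 < e -> exists2 w : R, 0 < w &
  forall x y z, udist x y < w -> udist (bmul x z) (bmul y z) <= e.
Proof.
(* Two inversions are made: [w'] controls the outer one, and [w] brings the inner one below [w']. *)
move=> /Ginv[w' /Ginv[w w0 H] H']; exists w => // x y z /udist_lt_near xy.
apply: udist_le_near; apply: filterS3 H H' xy => n H H' /H xy.
apply/ltW; rewrite -[X in mdist X]invgK -[X in mdist _ X]invgK.
by apply: H'; rewrite !invgM mdist_mul2l.
Qed.

Lemma ueq_le (x y : bseq) : (forall e : R, 0 < e -> udist x y <= e) -> ueq x y.
Proof.
move=> xy; rewrite /ueq eq_le udist_ge0 andbT.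
by apply/ler_addgt0Pl => e /xy; rewrite addr0.
Qed.

Lemma ueqV x y : ueq x y -> ueq (binv x) (binv y).
Proof.
by move=> /eqP xy; apply: ueq_le => e /binv_equi[w w0]; apply; rewrite xy.
Qed.

Lemma ueqM x x' y y' : ueq x x' -> ueq y y' -> ueq (bmul x y) (bmul x' y').
Proof.
move=> /eqP xx /eqP yy; apply: ueq_le => e /bmul_equir[w w0 H].
rewrite (le_trans (udist_triangle (bmul x' y) _ _))// bmul2l yy addr0.
by apply: H; rewrite xx.
Qed.

Definition up_one : L := cls bone.
Definition up_mul (p q : L) : L := cls (bmul (rep p) (rep q)).
Definition up_inv (p : L) : L := cls (binv (rep p)).

Lemma up_mulE x y : up_mul (cls x) (cls y) = cls (bmul x y).
Proof. by apply/ueqP/ueqM; exact: repK. Qed.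

Lemma up_invE x : up_inv (cls x) = cls (binv x).
Proof. exact/ueqP/ueqV/repK. Qed.

Lemma up_ind (P : L -> Prop) : (forall x, P (cls x)) -> forall p, P p.
Proof. by move=> H p; rewrite -(clsK p). Qed.

Lemma bseqP (x y : bseq) : (forall n, val x n = val y n) -> x = y.
Proof. by move=> xy; apply/val_inj/functional_extensionality_dep. Qed.

Lemma up_mulA : associative up_mul.
Proof.
elim/up_ind=> x; elim/up_ind=> y; elim/up_ind=> z; rewrite !up_mulE.
by congr (cls _); apply: bseqP => n /=; rewrite mulgA.
Qed.

Lemma up_mul1l : left_id up_one up_mul.
Proof.
elim/up_ind=> x; rewrite up_mulE.
by congr (cls _); apply: bseqP => n /=; rewrite mul1g.
Qed.

Lemma up_mulr1 : right_id up_one up_mul.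
Proof.
elim/up_ind=> x; rewrite up_mulE.
by congr (cls _); apply: bseqP => n /=; rewrite mulg1.
Qed.

Lemma up_mulV : left_inverse up_one up_inv up_mul.
Proof.
elim/up_ind=> x; rewrite up_invE up_mulE.
by congr (cls _); apply: bseqP => n /=; rewrite mulVg.
Qed.

Lemma up_mulrV : right_inverse up_one up_inv up_mul.
Proof.
elim/up_ind=> x; rewrite up_invE up_mulE.
by congr (cls _); apply: bseqP => n /=; rewrite mulgV.
Qed.

HB.instance Definition _ := isGroup.Build L
  up_mulA up_mul1l up_mulr1 up_mulV up_mulrV.

Lemma mul_cls x y : ((cls x : L) * cls y)%g = cls (bmul x y).
Proof. exact: up_mulE. Qed.

Lemma inv_cls x : ((cls x : L)^-1)%g = cls (binv x).
Proof. exact: up_invE. Qed.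

Lemma up_mdist_mul2l (g h k : L) : mdist (g * h)%g (g * k)%g = mdist h k.
Proof.
elim/up_ind: g => x; elim/up_ind: h => y; elim/up_ind: k => z.
by rewrite !mul_cls !mdist_cls bmul2l.
Qed.

Lemma up_mulg_continuous : continuous (fun p : L * L => (p.1 * p.2)%g).
Proof.
move=> [g h]; apply/metricType_numDomainType.cvgrPdist_le => e e0.
have e2 : 0 < e / 2 by rewrite divr_gt0.
have [w w0 H] := bmul_equir e2.
exists (ball g w, ball h (e / 2)); first by split; exact: nbhsx_ballx.
move=> [g' h'] /= []; rewrite !ballEmdist/= => gg hh.
(* Changing [h] is isometric by left invariance. Changing [g] is controlled by [w], which serves all
   right factors [h'] at once. *)
rewrite (le_trans (metric_triangle _ (g * h')%g _))// [leRHS]splitr lerD//.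
  by rewrite up_mdist_mul2l ltW.
elim/up_ind: g gg => x; elim/up_ind: g' => y; elim/up_ind: h' {hh} => z.
by rewrite !mul_cls !mdist_cls; exact: H.
Qed.

HB.instance Definition _ :=
  isMetricMonoid.Build R L up_mdist_mul2l up_mulg_continuous.

Lemma up_invg_continuous : continuous (fun g : L => (g^-1)%g).
Proof.
move=> g; apply/(@metricType_numDomainType.cvgrPdist_le _ _ _ (nbhs g)).
move=> e /binv_equi[w w0 H].
apply/nbhs_ballP; exists w => // g'; rewrite ballEmdist/=.
elim/up_ind: g => x; elim/up_ind: g' => y.
by rewrite !inv_cls !mdist_cls; exact: H.
Qed.

HB.instance Definition _ := isMetricGroup.Build R L up_invg_continuous.

Lemma mdist_cls_cvg x y :
  mdist (val x n) (val y n) @[n --> U] --> mdist (cls x : L) (cls y).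
Proof. by rewrite mdist_cls; exact: udist_cvg. Qed.

Lemma cls_near x y : (\forall n \near U, val x n = val y n) -> cls x = cls y.
Proof.
move=> xy; apply/ueqP; apply: ueq_le => e e0; apply: udist_le_near.
by apply: filterS xy => n ->; rewrite mdistxx ltW.
Qed.

(** * Completeness of the ultraproduct *)

Section completeness.
Variables (F : set_system L) (PF : ProperFilter F).

(* Along an approximating sequence [p k] for [F], the [n]-th entry of the limit
   is that of [p (k n)], where [k n <= n] is the largest index up to which the
   [n]-th entries of the [p i] are as close to one another as the [p i]. *)
Lemma up_complete : \oo `<=` U -> cauchy_ex F -> exists y : L, F --> y.
Proof.
move=> Uoo Fc; pose e k : R := k.+1%:R^-1.
have e0 k : 0 < e k by rewrite invr_gt0.
have le_e i j : (i <= j)%N -> e j <= e i.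
  by move=> ij; rewrite lef_pV2 ?posrE// ler_nat.
have /choice[p Fp] : forall k, exists p : L, F (ball p (e k)).
  by move=> k; exact: Fc.
pose x k := rep (p k).
have xp k : cls (x k) = p k by exact: clsK.
pose close n i j := mdist (val (x i) n) (val (x j) n) < e i + e j.
pose good n k := `[< forall i j, (i <= k)%N -> (j <= k)%N -> close n i j >].
have /choice[k kP] : forall n, exists k,
    good n k /\ forall j, (j <= n)%N -> good n j -> (j <= k)%N.
  move=> n; pose Q k := (k <= n)%N && good n k.
  have Q0 : exists k, Q k.
    (* Index 0 is good for every [n], since only the pair (0, 0) is tested; hence a largest good
       index up to [n] exists. *)
    exists 0%N; apply/asboolP => i j; rewrite !leqn0 => /eqP-> /eqP->.
    by rewrite /close mdistxx addr_gt0.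
  have Qn j : Q j -> (j <= n)%N by case/andP.
  case: (ex_maxnP Q0 Qn) => k /andP[_ gk] kmax; exists k; split=> // j jn gj.
  by apply: kmax; rewrite /Q jn gj.
pose y n := val (x (k n)) n.
have xy n i : (i <= k n)%N -> mdist (val (x i) n) (y n) <= e i + e i.
  move=> ik; have /asboolP/(_ i (k n) ik (leqnn _))/ltW/le_trans := (kP n).1.
  by apply; rewrite lerD2l le_e.
have yM : bounded_seq y.
  have /asboolP[M xM] := valP (x 0%N); exists (M + (e 0%N + e 0%N)) => n.
  rewrite (le_trans (metric_triangle _ (val (x 0%N) n) _))//.
  by rewrite lerD//; [exact: xM|exact: xy].
have good_near i : \forall n \near U, good n i.
  (* Balls in [F] intersect, so [p a] and [p b] are closer than [e a + e b]. Each such strict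
     inequality passes to [U]-almost all entries, and there are finitely many pairs. *)
  have H : \forall n \near U, forall ij : 'I_i.+1 * 'I_i.+1,
      close n ij.1 ij.2.
    apply: filter_forall => -[a b] /=.
    apply: udist_lt_near; rewrite -mdist_cls !xp.
    have /filter_ex[z []] : F (ball (p a) (e a) `&` ball (p b) (e b)).
      exact: filterI.
    rewrite !ballEmdist/= => az bz.
    rewrite (le_lt_trans (metric_triangle _ z _))// ltrD//.
    by rewrite metric_sym.
  apply: filterS H => n H; apply/asboolP => a b ai bi.
  exact: (H (@Ordinal i.+1 a ai, @Ordinal i.+1 b bi)).
pose l : L := cls (mk_bseq yM).
have py i : mdist (p i) l <= e i + e i.
  rewrite -xp mdist_cls; apply: udist_le_near.
  (* The cap [k n <= n] is harmless because [U] refines the Frechet filter: [i <= k n] for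
     [U]-almost all [n]. *)
  have ni : \forall n \near U, (i <= n)%N by apply: Uoo; exists i.
  apply: filterS2 ni (good_near i) => n ni gi.
  by apply: xy; exact: (kP n).2.
exists l.
apply/(@metricType_numDomainType.fcvgrPdist_lt R L F) => d d0.
have d3 : 0 < d / 3 by rewrite divr_gt0.
(* The distance from [l] to [z] is below [3 * e i]: twice [e i] to reach [p i], once for the
   ball. *)
have [i _ /(_ i (leqnn _)) /= id3] := near_infty_natSinv_lt (PosNum d3).
apply: filterS (Fp i) => z; rewrite ballEmdist/= => iz.
have := metric_triangle l (p i) z; have := py i.
by rewrite (metric_sym l (p i)) -/(e i) in id3 *; lra.
Qed.

End completeness.

(** * Ultralimits of almost isometries *)

(** Images under almost isometries are bounded only for [U]-almost all [n]; clipping bounds every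
    entry. The bound is [|M|] because a negative [M] turns all entries into 1. *)
Lemma bounded_clip (x : forall n, G n) (M : R) :
  bounded_seq (fun n => if mdist 1%g (x n) <= M then x n else 1%g).
Proof.
exists `|M| => n; case: ifPn => [xM|_]; last by rewrite mdistxx.
exact: le_trans xM (ler_norm _).
Qed.

Lemma up_UIso (P : properMonoidType R) (e e' : R) : 0 < e' -> e' < e ->
  (\forall n \near U, UIso P (G n) e' e'^-1 !=set0) -> UIso P L e e^-1 !=set0.
Proof.
move=> e'0 e'e; have e0 : 0 < e := lt_trans e'0 e'e.
have rr : e^-1 < e'^-1 by rewrite ltf_pV2.
set r := e^-1 in rr *; set r' := e'^-1 in rr *.
have r0 : 0 <= r by rewrite invr_ge0 ltW.
have r'0 : 0 <= r' by rewrite invr_ge0 ltW.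
move=> PG.
(* Constant maps serve as defaults at the [U]-negligible indices without an almost isometry. *)
have stE n : {st : (P -> G n) * (G n -> P) |
    UIso P (G n) e' r' !=set0 -> UIso P (G n) e' r' st}.
  apply: cid; have [[st stP]|nP] := pselect (UIso P (G n) e' r' !=set0).
    by exists st.
  by exists (fun=> 1%g, fun=> 1%g).
pose s n := (sval (stE n)).1; pose t n := (sval (stE n)).2.
have stP : \forall n \near U, UIso P (G n) e' r' (s n, t n).
  by apply: filterS PG => n /(svalP (stE n)); rewrite /s /t; case: sval.
pose sb (g : P) : bseq := mk_bseq (bounded_clip (fun n => s n g) (r' + e')).
(* The representative of 1 is forced to be constant so that [T 1 = 1]. *)
pose hb (h : L) : bseq := if h == 1%g then bone else rep h.
have hbK h : cls (hb h) = h.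
  by rewrite /hb; case: eqP => [->//|_]; exact: clsK.
pose S g : L := cls (sb g).
(* The default 1 matters only outside the ball of radius [r]; inside it, [TP] provides the limit. *)
pose T (h : L) : P :=
  xget 1%g [set l : P | t n (val (hb h) n) @[n --> U] --> l].
have sbE g : idball r g -> \forall n \near U, val (sb g) n = s n g.
  move=> gr; apply: filterS stP => n stP.
  rewrite /= ifT//; apply: (UIso_norm r'0 stP).
  by rewrite /idball /mclosed_ball/= (le_trans gr)// ltW.
have hbr h : idball r h -> \forall n \near U, idball r' (val (hb h) n).
  rewrite /idball /mclosed_ball/= => hr.
  (* The gap [r < r'] is essential: only a strict bound on a limit passes to [U]-almost all
     entries. *)
  have : udist bone (hb h) < r' by rewrite -mdist_cls hbK (le_lt_trans hr).
  by move/udist_lt_near; apply: filterS => n /ltW.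
have TP h : idball r h -> t n (val (hb h) n) @[n --> U] --> T h.
  move=> hr.
  suff tE : exists l : P, t n (val (hb h) n) @[n --> U] --> l.
    exact: (xgetPex (1%g : P) tE).
  have := @mclosed_ball_compact R P 1%g (r' + e'); rewrite compact_ultra.
  case/(_ _ (ultra_fmap (fun n => t n (val (hb h) n)) UU)) => [|l []].
    apply: filterS2 stP (hbr h hr) => n /UIso_sym stP hr'.
    exact: (UIso_norm r'0 stP).
  by exists l.
exists (S, T); split; split=> /=.
- apply: (@cls_near (sb 1%g) bone); apply: filterS2 stP (sbE _ (idball1 P r0)).
  by move=> n [[/= s1 _] _] ->; rewrite s1.
- move=> g g' h gr g'r hr.
  have A := @mdist_cls_cvg (bmul (sb g) (sb g')) (hb h).
  have B : mdist (g * g')%g (t n (val (hb h) n)) @[n --> U] -->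
      mdist (g * g')%g (T h).
    by apply: cvg_mdist; [exact: cvg_cst|exact: TP].
  rewrite -mul_cls hbK in A.
  (* Both distances converge along [U], so the entrywise bound [e'] survives in the limit. *)
  apply: (cvgr_to_le (cvg_norm (cvgB A B))).
  apply: filterS2 stP (filterI (hbr h hr) (filterI (sbE g gr) (sbE g' g'r))).
  move=> n stP [hn [sg sg']]; apply: le_trans (ltW e'e).
  change (`|mdist (val (sb g) n * val (sb g') n)%g (val (hb h) n)
            - mdist (g * g')%g (t n (val (hb h) n))| <= e').
  rewrite sg sg'.
  apply: stP.1.2; [|exact: idball_le (ltW rr) _ g'r|exact: hn].
  exact: idball_le (ltW rr) _ gr.
- have T1 : t n (val (hb 1%g) n) @[n --> U] --> (1%g : P).
    apply: cvg_trans (near_eq_cvg _) (cvg_cst _).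
    by apply: filterS stP => n [_ [/= tn1 _]]; rewrite /hb eqxx tn1.
  exact: (cvg_unique (@metric_hausdorff R P) (TP _ (idball1 L r0)) T1).
- move=> g g' h gr g'r hr.
  have A : mdist (t n (val (hb g) n) * t n (val (hb g') n))%g h @[n --> U] -->
      mdist (T g * T g')%g h.
    by apply: cvg_mdist; [apply: mulg_cvg; exact: TP|exact: cvg_cst].
  have B := @mdist_cls_cvg (bmul (hb g) (hb g')) (sb h).
  rewrite -mul_cls !hbK in B.
  apply: (cvgr_to_le (cvg_norm (cvgB A B))).
  apply: filterS2 stP (filterI (sbE h hr) (filterI (hbr g gr) (hbr g' g'r))).
  move=> n stP [sh [gn g'n]]; apply: le_trans (ltW e'e).
  change (`|mdist (t n (val (hb g) n) * t n (val (hb g') n))%g h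
            - mdist (val (hb g) n * val (hb g') n)%g (val (sb h) n)| <= e').
  rewrite sh.
  by apply: stP.2.2; [exact: gn|exact: g'n|exact: idball_le (ltW rr) _ hr].
Qed.

End ultraproduct.

(** * Convergence of the Cauchy sequence to its ultraproduct *)

Unset Implicit Arguments.

Theorem corollary3p6 (R : realType) (G : nat -> properGroupType R)
    (G_cauchy : Upsilon_cauchy (fun n => G n))
    (G_inv : forall eps : R, 0 < eps ->
       exists omega : R, 0 < omega /\ exists N : nat,
         forall n : nat, (N <= n)%N -> forall g h : G n,
           mdist g h < omega -> mdist (g^-1)%g (h^-1)%g < eps) :
  exists L : properGroupType R, Upsilon (G n) L @[n --> \oo] --> (0 : R).
Proof.
have [U [UU Uoo]] := @ultraFilterLemma nat \oo _.
have UG : equi_inv G U.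
  move=> e /G_inv[w [w0 [N H]]]; exists w => //; apply: Uoo.
  by exists N => // n; exact: H.
pose L0 : metricGroupType R := @ultraproduct R G U UU UG.
have GL (e : R) : 0 < e -> exists N, forall n, (N <= n)%N ->
    UIso (G n) L0 e e^-1 !=set0.
  (* [e / 2] leaves the gap [e' < e] for the ultralimit; [sqrt 2 / 2] is the threshold of
     [Upsilon_lt]. *)
  move=> e0; pose e' := Num.min (e / 2) (Num.sqrt 2 / 2).
  have e'0 : 0 < e' by rewrite lt_min !divr_gt0// sqrtr_gt0.
  have [N HN] := G_cauchy e' e'0; exists N => n Nn.
  apply: (@up_UIso R G U UU UG (G n) e e') => //.
    by rewrite gt_min ltr_pdivrMr// ltr_pMr// ltr1n.
  apply: Uoo; exists N => // m Nm.
  by apply: Upsilon_lt; [rewrite ge_min lexx orbT|exact: HN].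
have Lc : forall (x : L0) r, compact (mclosed_ball x r).
  apply: UIso_compact => [F PF|e /GL[N /(_ N (leqnn N)) GNL]].
    exact: up_complete.
  by exists (G N).
pose L : properGroupType R :=
  HB.pack_for (properGroupType R) L0 (isProperMetric.Build R L0 Lc).
exists L; apply/cvgrPdist_le => e e0; have [N GN] := GL e e0.
exists N => // n /= Nn; rewrite sub0r normrN ger0_norm ?Upsilon_ge0//.
by apply: (@Upsilon_le R (G n) L e e0); exact: GN.
Qed.
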